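(* Let $K$ be a field of characteristic $p>0$ and let $f\in K[x]$ be a monic nonscalar polynomial. Then the automorphism group of the $K$-algebra $\Lambda(f)=K[x][y;f\frac{d}{dx}]$ is the semidirect product $$\mathrm{Aut}_K(\Lambda(f))=\mathbb{S}(K)\rtimes G_f(K).$$
   Context: $\Lambda(f)=K[x][y;f\frac{d}{dx}]=K\langle x,y\mid yx-xy=f\rangle=\bigoplus_{i\ge 0}K[x]y^i$ is an Ore extension. $\mathrm{Aut}_K(K[x])=\{\sigma_{\lambda,\mu}\mid \lambda\in K^\times,\mu\in K\}$ where $\sigma_{\lambda,\mu}(x)=\lambda x+\mu$. The eigengroup of $f$ is $G_f(K)=\{\sigma\in \mathrm{Aut}_K(K[x])\mid \sigma(f)=\lambda_\sigma f\text{ for some }\lambda_\sigma\in K^\times\}$. It is identified with a subgroup of $\mathrm{Aut}_K(\Lambda(f))$ via the group monomorphism sending $\sigma_{\lambda,\mu}$ to the automorphism $x\mapsto \lambda x+\mu$, $y\mapsto \lambda^{\deg(f)-1}y$. $\mathbb{S}(K)=\{s_q\mid q\in K[x]\}\simeq (K[x],+)$ is the subgroup of $\mathrm{Aut}_K(\Lambda(f))$ where $s_q(x)=x$ and $s_q(y)=y+q$. A group $G$ is the semidirect product $N\rtimes H$ of a normal subgroup $N$ and a subgroup $H$ if $G=NH$ and $N\cap H=\{e\}$. *)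

(* Defs.v *)
From HB Require Import structures.
From mathcomp Require Import all_boot all_order all_algebra.
From mathcomp Require Import boolp classical_sets.

Set Implicit Arguments.
Unset Strict Implicit.
Unset Printing Implicit Defensive.

Import GRing.Theory.
Local Open Scope ring_scope.

Section Groups.
Variable G : groupType.
Implicit Types N H : set G.

Definition is_subgroup H : Prop :=
  [/\ H 1%g, forall x y, H x -> H y -> H (x * y)%g
    & forall x, H x -> H (x^-1)%g].

Definition is_normal_subgroup N : Prop :=
  is_subgroup N /\ forall g x, N x -> N (g * x * g^-1)%g.

Definition is_semidirect_product N H : Prop :=
  [/\ is_normal_subgroup N, is_subgroup H,
      forall g, exists n h, [/\ N n, H h & g = (n * h)%g]
    & forall g, N g /\ H g <-> g = 1%g].

End Groups.

Section AlgebraAutomorphisms.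
Variables (K : fieldType) (A : algType K).

Record alg_aut : Type := AlgAut {
  aut_fun :> A -> A;
  aut_linear : linear aut_fun;
  aut_monoid : monoid_morphism aut_fun;
  aut_bij : bijective aut_fun
}.

HB.instance Definition _ := gen_eqMixin alg_aut.
HB.instance Definition _ := gen_choiceMixin alg_aut.

HB.instance Definition _ (s : alg_aut) :=
  GRing.isLinear.Build K A A *:%R (aut_fun s) (aut_linear s).
HB.instance Definition _ (s : alg_aut) :=
  GRing.isMonoidMorphism.Build A A (aut_fun s) (aut_monoid s).

Lemma alg_autP (s t : alg_aut) : s =1 t -> s = t.
Proof.
move=> /funext; case: s t => [s ls ms bs] [t lt mt bt] /= st.
move: ls ms bs; rewrite st => ls ms bs.
by congr AlgAut; exact: Prop_irrelevance.
Qed.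

Fact id_linear : linear (@id A). Proof. by []. Qed.
Fact id_monoid : monoid_morphism (@id A). Proof. by []. Qed.
Fact id_bij : bijective (@id A). Proof. by exists id. Qed.

Definition aut_one : alg_aut := AlgAut id_linear id_monoid id_bij.

Fact aut_comp_linear (s t : alg_aut) : linear (s \o t).
Proof. by move=> a u v /=; rewrite !linearP. Qed.
Fact aut_comp_monoid (s t : alg_aut) : monoid_morphism (s \o t).
Proof. by split=> [|u v] /=; rewrite ?rmorph1 ?rmorphM. Qed.

Definition aut_mul (s t : alg_aut) : alg_aut :=
  AlgAut (aut_comp_linear s t) (aut_comp_monoid s t)
         (bij_comp (aut_bij s) (aut_bij t)).

Fact aut_inv_subproof (s : alg_aut) :
  exists g : A -> A, cancel s g /\ cancel g s.
Proof. by case: (aut_bij s) => g; exists g. Qed.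

Definition aut_inv_fun (s : alg_aut) : A -> A :=
  projT1 (cid (aut_inv_subproof s)).

Lemma aut_invK (s : alg_aut) : cancel s (aut_inv_fun s).
Proof. by rewrite /aut_inv_fun; case: cid => g []. Qed.

Lemma autK_inv (s : alg_aut) : cancel (aut_inv_fun s) s.
Proof. by rewrite /aut_inv_fun; case: cid => g []. Qed.

Fact aut_inv_linear (s : alg_aut) : linear (aut_inv_fun s).
Proof.
by move=> a u v; apply: (can_inj (aut_invK s)); rewrite linearP /= !autK_inv.
Qed.
Fact aut_inv_monoid (s : alg_aut) : monoid_morphism (aut_inv_fun s).
Proof.
split=> [|u v]; apply: (can_inj (aut_invK s)); first by rewrite rmorph1 autK_inv.
by rewrite rmorphM /= !autK_inv.
Qed.
Fact aut_inv_bij (s : alg_aut) : bijective (aut_inv_fun s).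
Proof. by exists s; [exact: autK_inv | exact: aut_invK]. Qed.

Definition aut_inv (s : alg_aut) : alg_aut :=
  AlgAut (aut_inv_linear s) (aut_inv_monoid s) (aut_inv_bij s).

Fact aut_mulA : associative aut_mul.
Proof. by move=> s t u; apply: alg_autP. Qed.
Fact aut_mul1g : left_id aut_one aut_mul.
Proof. by move=> s; apply: alg_autP. Qed.
Fact aut_mulg1 : right_id aut_one aut_mul.
Proof. by move=> s; apply: alg_autP. Qed.
Fact aut_mulVg : left_inverse aut_one aut_inv aut_mul.
Proof. by move=> s; apply: alg_autP => x; exact: aut_invK. Qed.
Fact aut_mulgV : right_inverse aut_one aut_inv aut_mul.
Proof. by move=> s; apply: alg_autP => x; exact: autK_inv. Qed.

(* The group law is composition: (s * t) x = s (t x). *)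
HB.instance Definition _ := isGroup.Build alg_aut
  aut_mulA aut_mul1g aut_mulg1 aut_mulVg aut_mulgV.

Lemma aut1E (x : A) : (1%g : alg_aut) x = x. Proof. by []. Qed.
Lemma autME (s t : alg_aut) (x : A) : (s * t)%g x = s (t x).
Proof. by []. Qed.

End AlgebraAutomorphisms.

(* An element \sum_i a_i y^i of K[x][y; f d/dx], coefficients on the left, is
   stored as the polynomial with i-th coefficient a_i; only the addition is
   that of {poly {poly K}}. *)
Definition Lambda (K : fieldType) (f : {poly K}) : Type := {poly {poly K}}.

Section OreExtension.
Variables (K : fieldType) (f : {poly K}).
Local Notation L := (Lambda f).

HB.instance Definition _ := GRing.Zmodule.copy L {poly {poly K}}.

Definition ore_der (a : {poly K}) : {poly K} := f * a^`().

Fact ore_der_is_additive : zmod_morphism ore_der.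
Proof. by move=> a b; rewrite /ore_der derivB mulrBr. Qed.
HB.instance Definition _ :=
  GRing.isZmodMorphism.Build _ _ ore_der ore_der_is_additive.

(* Left multiplication by y, from y a = a y + f a'. *)
Definition ore_lmuly (P : {poly {poly K}}) : {poly {poly K}} :=
  P * 'X + map_poly ore_der P.

Fact ore_lmuly_is_additive : zmod_morphism ore_lmuly.
Proof.
move=> P Q; rewrite /ore_lmuly mulrBl raddfB /= opprD.
by rewrite addrACA.
Qed.
HB.instance Definition _ :=
  GRing.isZmodMorphism.Build _ _ ore_lmuly ore_lmuly_is_additive.

Definition ore_mul (P Q : L) : L :=
  \sum_(i < size (P : {poly {poly K}}))
     (P : {poly {poly K}})`_i *: iter i ore_lmuly Q.

Definition ore_const (a : {poly K}) : L := a%:P.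
Definition ore_x : L := ore_const 'X.
Definition ore_y : L := 'X.

Fact ore_mulE n (P Q : L) : (size (P : {poly {poly K}}) <= n)%N ->
  ore_mul P Q =
  \sum_(i < n) (P : {poly {poly K}})`_i *: iter i ore_lmuly Q.
Proof.
move=> le; rewrite /ore_mul.
rewrite (big_ord_widen n
  (fun i => (P : {poly {poly K}})`_i *: iter i ore_lmuly Q)) // big_mkcond.
apply: eq_bigr => i _ /=; case: ltnP => // h.
by rewrite nth_default // scale0r.
Qed.

Fact ore_mulDl : left_distributive ore_mul +%R.
Proof.
move=> P Q R.
set n := maxn (size (P : {poly {poly K}})) (size (Q : {poly {poly K}})).
rewrite (@ore_mulE n (P + Q)) ?size_polyD // (@ore_mulE n P) ?leq_maxl //.
rewrite (@ore_mulE n Q) ?leq_maxr // -big_split /=.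
by apply: eq_bigr => i _; rewrite coefD scalerDl.
Qed.

Fact iter_lmuly_is_additive i : zmod_morphism (iter i ore_lmuly).
Proof. by elim: i => [|i IH] P Q //=; rewrite IH raddfB. Qed.
HB.instance Definition _ i :=
  GRing.isZmodMorphism.Build _ _ (iter i ore_lmuly) (iter_lmuly_is_additive i).

Fact ore_mulDr : right_distributive ore_mul +%R.
Proof.
move=> P Q R; rewrite /ore_mul -big_split /=.
by apply: eq_bigr => i _; rewrite raddfD scalerDr.
Qed.

Fact ore_mul0l : left_zero 0 ore_mul.
Proof. by move=> P; rewrite /ore_mul size_poly0 big_ord0. Qed.

Fact ore_mul_sumr (I : Type) (r : seq I) (F : I -> L) (P : L) :
  ore_mul P (\sum_(i <- r) F i) = \sum_(i <- r) ore_mul P (F i).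
Proof.
elim: r => [|i r IH]; last by rewrite !big_cons ore_mulDr IH.
rewrite !big_nil /ore_mul big1 // => i _; by rewrite raddf0 scaler0.
Qed.

Fact ore_mul_suml (I : Type) (r : seq I) (F : I -> L) (P : L) :
  ore_mul (\sum_(i <- r) F i) P = \sum_(i <- r) ore_mul (F i) P.
Proof.
elim: r => [|i r IH]; last by rewrite !big_cons ore_mulDl IH.
by rewrite !big_nil ore_mul0l.
Qed.

Fact ore_mulZ (a : {poly K}) (P Q : L) :
  ore_mul (a *: (P : {poly {poly K}})) Q =
  a *: (ore_mul P Q : {poly {poly K}}).
Proof.
rewrite (@ore_mulE (size (P : {poly {poly K}}))) ?size_scale_leq //.
rewrite /ore_mul scaler_sumr; apply: eq_bigr => i _.
by rewrite coefZ scalerA.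
Qed.

Fact ore_mulXn n (Q : L) : ore_mul ('X^n : {poly _}) Q = iter n ore_lmuly Q.
Proof.
rewrite (@ore_mulE n.+1) ?size_polyXn // big_ord_recr /= coefXn eqxx scale1r.
rewrite big1 ?add0r // => i _.
by rewrite coefXn ltn_eqF // scale0r.
Qed.

Fact ore_mul1l : left_id (1 : {poly {poly K}}) ore_mul.
Proof. by move=> P; rewrite -(expr0 'X) ore_mulXn. Qed.

Fact ore_mulCl (a : {poly K}) (Q : L) :
  ore_mul (ore_const a) Q = a *: (Q : {poly {poly K}}).
Proof.
have -> : ore_const a = a *: (1 : {poly {poly K}}).
  by rewrite /ore_const -mul_polyC mulr1.
by rewrite ore_mulZ ore_mul1l.
Qed.

Fact ore_lmulyZ (a : {poly K}) (P : {poly {poly K}}) :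
  ore_lmuly (a *: P) = a *: ore_lmuly P + ore_der a *: P.
Proof.
apply/polyP=> i; rewrite /ore_lmuly !(coefD, coefZ, coefMX).
rewrite !coef_map_id0 ?raddf0 // !coefZ {1 2}/ore_der derivM.
by case: (i == 0%N); rewrite /ore_der mulrDr mulrDr ?mulr0 ?add0r; 
  rewrite (mulrCA f a) [_ + a * _]addrC ?addrA mulrA.
Qed.

Fact ore_der1 : ore_der 1 = 0.
Proof. by rewrite /ore_der derivC mulr0. Qed.

Fact ore_lmulyXn n : ore_lmuly ('X ^+ n) = 'X ^+ n.+1.
Proof.
rewrite /ore_lmuly -exprSr; apply/polyP=> i.
rewrite coefD coef_map_id0 ?raddf0 // [in X in _ + ore_der X]coefXn.
by case: eqP => _ /=; rewrite ?ore_der1 ?raddf0 addr0.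
Qed.

Fact iter_lmuly1 n :
  iter n ore_lmuly (1 : {poly {poly K}}) = 'X^n.
Proof. by elim: n => [|n /= ->]; rewrite ?expr0 // ore_lmulyXn. Qed.

Fact ore_mulr1 : right_id (1 : {poly {poly K}}) ore_mul.
Proof.
move=> P; rewrite /ore_mul -[RHS]coefK poly_def.
by apply: eq_bigr => i _; rewrite iter_lmuly1.
Qed.

Fact ore_lmuly_mul (P Q : L) :
  ore_mul (ore_lmuly P) Q = ore_lmuly (ore_mul P Q).
Proof.
rewrite -[P in LHS]coefK poly_def raddf_sum ore_mul_suml.
rewrite /(ore_mul P) raddf_sum; apply: eq_bigr => i _ /=.
rewrite !ore_lmulyZ ore_mulDl !ore_mulZ ore_lmulyXn !ore_mulXn.
by [].
Qed.

Fact iter_lmuly_mul n (P Q : L) :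
  ore_mul (iter n ore_lmuly P) Q = iter n ore_lmuly (ore_mul P Q).
Proof. by elim: n => [|n IH] //=; rewrite ore_lmuly_mul IH. Qed.

Fact ore_mulA : associative ore_mul.
Proof.
move=> P Q R; rewrite [in RHS]/(ore_mul P Q) ore_mul_suml.
by apply: eq_bigr => i _; rewrite ore_mulZ iter_lmuly_mul.
Qed.

Fact ore_oner_neq0 : (1 : {poly {poly K}}) != 0 :> L.
Proof. exact: oner_neq0. Qed.

HB.instance Definition _ := GRing.Zmodule_isNzRing.Build L
  ore_mulA ore_mul1l ore_mulr1 ore_mulDl ore_mulDr ore_oner_neq0.

Definition ore_scale (c : K) (P : L) : L :=
  c%:P *: (P : {poly {poly K}}).

Fact ore_scaleA a b v : ore_scale a (ore_scale b v) = ore_scale (a * b) v.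
Proof. by rewrite /ore_scale scalerA polyCM. Qed.
Fact ore_scale1 : left_id 1 ore_scale.
Proof. by move=> v; rewrite /ore_scale scale1r. Qed.
Fact ore_scaleDr : right_distributive ore_scale +%R.
Proof. by move=> a u v; rewrite /ore_scale scalerDr. Qed.
Fact ore_scaleDl v : {morph ore_scale^~ v : a b / a + b}.
Proof. by move=> a b; rewrite /ore_scale polyCD scalerDl. Qed.

HB.instance Definition _ := GRing.Zmodule_isLmodule.Build K L
  ore_scaleA ore_scale1 ore_scaleDr ore_scaleDl.

Fact ore_scaleAl (a : K) (u v : L) : a *: (u * v) = (a *: u) * v.
Proof. exact/esym/ore_mulZ. Qed.

HB.instance Definition _ :=
  GRing.Lmodule_isLalgebra.Build K L ore_scaleAl.

Fact ore_lmulyZK (c : K) (P : {poly {poly K}}) :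
  ore_lmuly (c%:P *: P) = c%:P *: ore_lmuly P.
Proof. by rewrite ore_lmulyZ /ore_der derivC mulr0 scale0r addr0. Qed.

Fact ore_scaleAr (a : K) (u v : L) : a *: (u * v) = u * (a *: v).
Proof.
rewrite -[RHS]/(ore_mul u (ore_scale a v)) -[LHS]/(ore_scale a (ore_mul u v)).
rewrite /ore_scale /ore_mul scaler_sumr; apply: eq_bigr => i _.
have -> : iter i ore_lmuly (a%:P *: v) = a%:P *: iter i ore_lmuly v.
  by elim: (i : nat) => [|j IH] //=; rewrite IH ore_lmulyZK.
by rewrite !scalerA mulrC.
Qed.

HB.instance Definition _ :=
  GRing.Lalgebra_isAlgebra.Build K L ore_scaleAr.

End OreExtension.

Section Presentation.
Variables (K : fieldType) (f : {poly K}).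
Local Notation L := (Lambda f).

Lemma ore_const_inj : injective (ore_const f).
Proof. by move=> a b; rewrite /ore_const => /polyC_inj. Qed.

Fact ore_const_is_additive : zmod_morphism (ore_const f).
Proof. exact: polyCB. Qed.
HB.instance Definition _ :=
  GRing.isZmodMorphism.Build {poly K} L (ore_const f) ore_const_is_additive.
Fact ore_const_is_monoid_morphism : monoid_morphism (ore_const f).
Proof.
split=> // a b; rewrite -[RHS]/(ore_mul (ore_const f a) (ore_const f b)).
by rewrite ore_mulCl /ore_const -mul_polyC polyCM.
Qed.
HB.instance Definition _ :=
  GRing.isMonoidMorphism.Build {poly K} L (ore_const f)
    ore_const_is_monoid_morphism.
Fact ore_const_is_scalable : scalable (ore_const f).
Proof.
move=> c a; rewrite -[RHS]/(ore_scale c (ore_const f a)) /ore_scale /ore_const.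
by rewrite -!mul_polyC polyCM.
Qed.
HB.instance Definition _ :=
  GRing.isScalable.Build K {poly K} L *:%R (ore_const f) ore_const_is_scalable.

Lemma ore_yM (P : L) : ore_y f * P = ore_lmuly f P.
Proof.
rewrite -[LHS]/(ore_mul (ore_y f) P).
by rewrite -[ore_y f]/('X ^+ 1 : {poly {poly K}}) ore_mulXn.
Qed.

Lemma ore_constM (a : {poly K}) (P : L) :
  ore_const f a * P = a *: (P : {poly {poly K}}).
Proof. exact: ore_mulCl. Qed.

Lemma ore_y_const (a : {poly K}) :
  ore_y f * ore_const f a
  = ore_const f a * ore_y f + ore_const f (f * a^`()).
Proof.
rewrite ore_yM ore_constM -[ore_const f a in LHS]/(a%:P : {poly {poly K}}).
rewrite -[a%:P]mulr1 mul_polyC ore_lmulyZ -(expr0 'X) ore_lmulyXn expr0 expr1.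
by rewrite -[ore_der f a *: 1]mul_polyC mulr1.
Qed.

Lemma ore_rel : ore_y f * ore_x f - ore_x f * ore_y f = ore_const f f.
Proof. by rewrite ore_y_const derivX mulr1 addrAC subrr add0r. Qed.

Lemma ore_yX n : ore_y f ^+ n = ('X ^+ n : {poly {poly K}}).
Proof.
elim: n => [|n IH]; first by rewrite !expr0.
by rewrite exprS IH ore_yM ore_lmulyXn.
Qed.

Lemma ore_expand (P : L) :
  P = \sum_(i < size (P : {poly {poly K}}))
        ore_const f (P : {poly {poly K}})`_i * ore_y f ^+ i.
Proof.
rewrite -[LHS]coefK poly_def; apply: eq_bigr => i _.
by rewrite ore_constM ore_yX.
Qed.

Section Lift.
Variables (B : algType K) (a b : B).

(* The algebra morphism Lambda f -> B with x |-> a and y |-> b. *)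
Definition ore_lift (P : L) : B := (map_poly (horner_alg a) P).[b].

Lemma ore_lift_const p : ore_lift (ore_const f p) = horner_alg a p.
Proof. by rewrite /ore_lift map_polyC hornerC. Qed.

Lemma ore_lift_x : ore_lift (ore_x f) = a.
Proof. by rewrite ore_lift_const /= horner_algX. Qed.

Lemma ore_lift_y : ore_lift (ore_y f) = b.
Proof. by rewrite /ore_lift map_polyX hornerX. Qed.

Fact ore_lift_additive : zmod_morphism ore_lift.
Proof. by move=> P Q; rewrite /ore_lift raddfB hornerD hornerN. Qed.

HB.instance Definition _ :=
  GRing.isZmodMorphism.Build L B ore_lift ore_lift_additive.

Fact ore_liftZ c (P : {poly {poly K}}) :
  ore_lift (c *: P) = horner_alg a c * ore_lift P.
Proof. by rewrite /ore_lift map_polyZ hornerZ. Qed.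

Fact ore_lift_linear : linear ore_lift.
Proof.
move=> c P Q.
rewrite raddfD /= -[c *: P]/(c%:P *: (P : {poly {poly K}})) ore_liftZ.
by rewrite horner_algC mulr_algl.
Qed.

Hypothesis hab : b * a - a * b = horner_alg a f.

Fact ore_lift_comm p :
  b * horner_alg a p = horner_alg a p * b + horner_alg a (f * p^`()).
Proof.
elim/poly_ind: p => [|p c IH].
  by rewrite derivC mulr0 !rmorph0 mulr0 mul0r addr0.
have -> : f * (p * 'X + c%:P)^`() = f * p^`() * 'X + p * f.
  by rewrite derivD derivC addr0 derivM derivX mulr1 mulrDr mulrA (mulrC p).
rewrite !(rmorphD, rmorphM) /= horner_algX horner_algC -!rmorphM.
rewrite mulrDr mulrDl mulr_algr mulr_algl mulrA IH mulrDl -!mulrA.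
have -> : b * a = a * b + horner_alg a f by rewrite -hab addrC subrK.
rewrite mulrDr -!rmorphM -!addrA; congr (_ + _).
by rewrite addrC [_ * a + _]addrC -addrA.
Qed.

Fact ore_liftXn n : ore_lift ('X ^+ n : {poly {poly K}}) = b ^+ n.
Proof. by rewrite /ore_lift map_polyXn hornerXn. Qed.

Fact ore_lift_lmuly (P : L) : ore_lift (ore_lmuly f P) = b * ore_lift P.
Proof.
rewrite -[P]coefK poly_def !raddf_sum mulr_sumr; apply: eq_bigr => i _ /=.
rewrite ore_lmulyZ ore_lmulyXn [LHS]raddfD /= !ore_liftZ !ore_liftXn.
by rewrite exprS !mulrA -mulrDl -ore_lift_comm.
Qed.

Fact ore_lift_monoid : monoid_morphism ore_lift.
Proof.
split=> [|P Q].
  by rewrite -[1]/(ore_const f 1) ore_lift_const rmorph1.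
rewrite -[P * Q]/(ore_mul P Q) /ore_mul raddf_sum /=.
have -> : ore_lift P = \sum_(i < size (P : {poly {poly K}}))
    ore_lift ((P : {poly {poly K}})`_i *: ('X ^+ i : {poly {poly K}})).
  by rewrite -[P in LHS]coefK poly_def raddf_sum.
rewrite mulr_suml.
apply: eq_bigr => i _; rewrite !ore_liftZ ore_liftXn -mulrA; congr (_ * _).
by elim: (i : nat) => [|n IH]; rewrite ?mul1r //= ore_lift_lmuly IH exprS mulrA.
Qed.

End Lift.

Lemma ore_morph_ext (B : algType K) (s t : {lrmorphism L -> B}) :
  s (ore_x f) = t (ore_x f) -> s (ore_y f) = t (ore_y f) -> s =1 t.
Proof.
move=> hx hy P; rewrite [P]ore_expand !rmorph_sum; apply: eq_bigr => i _.
rewrite !rmorphM !rmorphXn /= hy; congr (_ * _).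
elim/poly_ind: (P`_i) => [|p c IH]; first by rewrite !rmorph0.
rewrite !rmorphD !rmorphM /= IH hx; congr (_ + _).
by rewrite -[c%:P]alg_polyC !linearZ /= !rmorph1.
Qed.

End Presentation.

Section LambdaAutomorphisms.
Variables (K : fieldType) (f : {poly K}).
Local Notation L := (Lambda f).
Local Notation x := (ore_x f).
Local Notation y := (ore_y f).

Definition ore_lift_morph (B : algType K) (a b : B)
    (hab : b * a - a * b = horner_alg a f) : {lrmorphism L -> B} :=
  HB.pack (@ore_lift K f B a b)
    (GRing.isLinear.Build K L B *:%R (@ore_lift K f B a b)
       (@ore_lift_linear K f B a b))
    (GRing.isMonoidMorphism.Build L B (@ore_lift K f B a b)
       (ore_lift_monoid hab)).

Lemma ore_lift_bij (a b a' b' : L)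
    (hab : b * a - a * b = horner_alg a f)
    (hab' : b' * a' - a' * b' = horner_alg a' f) :
  ore_lift a b a' = x -> ore_lift a b b' = y ->
  ore_lift a' b' a = x -> ore_lift a' b' b = y ->
  bijective (ore_lift a b : L -> L).
Proof.
move=> h1 h2 h3 h4.
pose s := ore_lift_morph hab; pose t := ore_lift_morph hab'.
exists t.
- have st : t \o s =1 idfun.
    by apply: ore_morph_ext; rewrite /= ?ore_lift_x ?ore_lift_y.
  exact: st.
- have ts : s \o t =1 idfun.
    by apply: ore_morph_ext; rewrite /= ?ore_lift_x ?ore_lift_y.
  exact: ts.
Qed.

Lemma horner_alg_ore_const (a p : {poly K}) :
  horner_alg (ore_const f a) p = ore_const f (p \Po a).
Proof.
elim/poly_ind: p => [|p c IH]; first by rewrite comp_poly0 !rmorph0.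
rewrite rmorphD rmorphM /= horner_algX horner_algC IH comp_polyD comp_polyM.
rewrite comp_polyX comp_polyC !rmorphD rmorphM /=; congr (_ + _).
by rewrite -[c%:P]alg_polyC linearZ /= rmorph1.
Qed.

Fact shift_rel q :
  (y + ore_const f q) * x - x * (y + ore_const f q) = horner_alg x f.
Proof.
rewrite horner_alg_ore_const comp_polyXr mulrDl mulrDr opprD addrACA ore_rel.
by rewrite -!rmorphM /= [_ * q]mulrC subrr addr0.
Qed.

Fact shift_liftK q : ore_lift x (y + ore_const f q) (y + ore_const f (- q)) = y.
Proof.
rewrite raddfD /= ore_lift_y ore_lift_const horner_alg_ore_const comp_polyXr.
by rewrite rmorphN addrK.
Qed.

Fact shift_bij q : bijective (ore_lift x (y + ore_const f q) : L -> L).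
Proof.
apply: (ore_lift_bij (shift_rel q) (shift_rel (- q))); rewrite ?ore_lift_x //.
  exact: shift_liftK.
by rewrite -{2}[q]opprK shift_liftK.
Qed.

(* The automorphism x |-> x, y |-> y + q. *)
Definition shift_aut (q : {poly K}) : alg_aut L :=
  AlgAut (ore_lift_linear x (y + ore_const f q))
         (ore_lift_monoid (shift_rel q)) (shift_bij q).

Lemma shift_autX q : shift_aut q x = x.
Proof. exact: ore_lift_x. Qed.

Lemma shift_autY q : shift_aut q y = y + ore_const f q.
Proof. exact: ore_lift_y. Qed.

Lemma alg_aut_ext (s t : alg_aut L) : s x = t x -> s y = t y -> s = t.
Proof. by move=> hx hy; apply: alg_autP; exact: ore_morph_ext. Qed.

Lemma shift_aut_const q p : shift_aut q (ore_const f p) = ore_const f p.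
Proof. by rewrite /= ore_lift_const horner_alg_ore_const comp_polyXr. Qed.

Lemma shift_autD q r : shift_aut (q + r) = (shift_aut q * shift_aut r)%g.
Proof.
apply: alg_aut_ext; rewrite autME !(shift_autX, shift_autY) //.
have -> : shift_aut q (y + ore_const f r)
    = shift_aut q y + shift_aut q (ore_const f r) by exact: rmorphD.
by rewrite shift_autY shift_aut_const rmorphD addrA addrAC.
Qed.

Definition shift_group : set (alg_aut L) := [set s | exists q, s = shift_aut q].

Definition eigengroup : set (alg_aut {poly K}) :=
  [set s | exists c : K, c != 0 /\ s f = c *: f].

End LambdaAutomorphisms.

(* An automorphism s of K[x] is x |-> aut_slope s * x + aut_const s. *)
Section PolyAutomorphisms.
Variable K : fieldType.
Implicit Types s t : alg_aut {poly K}.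

Definition aut_slope s : K := (s 'X)`_1.
Definition aut_const s : K := (s 'X)`_0.

Lemma poly_autE s p : s p = p \Po s 'X.
Proof.
elim/poly_ind: p => [|p c IH]; first by rewrite comp_poly0 rmorph0.
rewrite rmorphD rmorphM /= IH comp_polyD comp_polyM comp_polyX comp_polyC.
by congr (_ + _); rewrite -alg_polyC linearZ /= rmorph1.
Qed.

Lemma size_poly_aut s : size (s 'X) = 2%N.
Proof.
have /(congr1 (fun p : {poly K} => (size p).-1)) : (s^-1)%g 'X \Po s 'X = 'X.
  by rewrite -poly_autE -autME mulgV aut1E.
rewrite size_comp_poly size_polyX /= => /eqP; rewrite muln_eq1 => /andP[_].
by case: size => [|[|[]]].
Qed.

Lemma poly_autX s : s 'X = aut_slope s *: 'X + (aut_const s)%:P.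
Proof.
apply/polyP=> i; rewrite coefD coefZ coefX coefC.
case: i => [|[|i]] /=; rewrite ?mulr0 ?add0r ?mulr1 ?addr0 //.
by rewrite nth_default // size_poly_aut.
Qed.

Lemma aut_slope_neq0 s : aut_slope s != 0.
Proof.
have : lead_coef (s 'X) != 0.
  by rewrite lead_coef_eq0 -size_poly_eq0 size_poly_aut.
by rewrite /lead_coef size_poly_aut.
Qed.

Lemma aut_slopeM s t : aut_slope (s * t)%g = aut_slope s * aut_slope t.
Proof.
rewrite /aut_slope autME (poly_autX t) poly_autE comp_polyD comp_polyZ.
rewrite comp_polyX comp_polyC coefD coefZ coefC addr0 mulrC.
by rewrite coefD coefZ coefX coefC mulr1 addr0.
Qed.

Lemma aut_slope1 : aut_slope 1%g = 1.
Proof. by rewrite /aut_slope aut1E coefX. Qed.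

End PolyAutomorphisms.

Section EigengroupEmbedding.
Variables (K : fieldType) (f : {poly K}).
Local Notation L := (Lambda f).
Local Notation x := (ore_x f).
Local Notation y := (ore_y f).
Implicit Types s t : alg_aut {poly K}.

(* The exponent deg f - 1 is an integer so that eigen_y also makes sense, and
   defines an automorphism, for constant f. *)
Definition eigen_x s : L := aut_slope s *: x + (aut_const s)%:A.
Definition eigen_y s : L := aut_slope s ^ ((size f).-1%:Z - 1) *: y.

Fact eigen_xE s : eigen_x s = ore_const f (s 'X).
Proof.
by rewrite poly_autX rmorphD /= linearZ /= -alg_polyC linearZ /= rmorph1.
Qed.

Lemma eigengroupE s : eigengroup f s -> s f = aut_slope s ^+ (size f).-1 *: f.
Proof.
have [->|f0] := eqVneq f 0; first by rewrite rmorph0 scaler0.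
move=> [c [_ e]]; rewrite e; congr (_ *: _).
have := congr1 lead_coef e; rewrite poly_autE lead_coef_comp ?size_poly_aut //.
rewrite lead_coefZ [lead_coef (s 'X)]/lead_coef size_poly_aut mulrC.
by move/(mulIf _) => -> //; rewrite lead_coef_eq0.
Qed.

Fact eigen_rel s : eigengroup f s ->
  eigen_y s * eigen_x s - eigen_x s * eigen_y s = horner_alg (eigen_x s) f.
Proof.
move=> hs; rewrite [in RHS]eigen_xE horner_alg_ore_const -poly_autE.
rewrite eigengroupE // linearZ /= -ore_rel /eigen_x /eigen_y.
set c := _ ^ _; rewrite mulrDr mulrDl mulr_algl mulr_algr opprD addrACA subrr.
rewrite addr0 -!scalerAl -!scalerAr !scalerA.
rewrite [_ * c]mulrC -scalerBr; congr (_ *: _).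
by rewrite /c -[X in _ * X]expr1z -expfzDr ?aut_slope_neq0 // subrK.
Qed.

Lemma eigengroupV s : eigengroup f s -> eigengroup f (s^-1)%g.
Proof.
move=> [c [c0 e]]; exists c^-1; split; first by rewrite invr_neq0.
apply: (bij_inj (aut_bij s)).
by rewrite -autME mulgV aut1E linearZ /= e scalerA mulVf // scale1r.
Qed.

Fact eigen_liftxE s t :
  ore_lift (eigen_x s) (eigen_y s) (eigen_x t) = eigen_x (s * t)%g.
Proof.
rewrite [eigen_x t]eigen_xE ore_lift_const !eigen_xE horner_alg_ore_const.
by rewrite -poly_autE.
Qed.

Fact eigen_liftyE s t :
  ore_lift (eigen_x s) (eigen_y s) (eigen_y t) = eigen_y (s * t)%g.
Proof.
have hZ c (P : L) : ore_lift (eigen_x s) (eigen_y s) (c *: P)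
    = c *: ore_lift (eigen_x s) (eigen_y s) P.
  rewrite -[c *: P]addr0 ore_lift_linear -[X in _ + X]/(ore_lift _ _ 0).
  by rewrite raddf0 addr0.
rewrite /(eigen_y t) hZ ore_lift_y scalerA /eigen_y aut_slopeM.
by rewrite expfzMl mulrC.
Qed.

Fact eigen_x1 : eigen_x 1%g = x.
Proof. by rewrite eigen_xE. Qed.

Fact eigen_y1 : eigen_y 1%g = y.
Proof. by rewrite /eigen_y aut_slope1 exp1rz scale1r. Qed.

Fact eigen_bij s (hs : eigengroup f s) :
  bijective (ore_lift (eigen_x s) (eigen_y s) : L -> L).
Proof.
apply: (ore_lift_bij (eigen_rel hs) (eigen_rel (eigengroupV hs)));
  by rewrite ?eigen_liftxE ?eigen_liftyE ?mulgV ?mulVg ?eigen_x1 ?eigen_y1.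
Qed.

(* For s : x |-> l * x + m in the eigengroup of f, the automorphism
   x |-> l * x + m, y |-> l^(deg f - 1) * y of Lambda f. *)
Definition eigen_aut s (hs : eigengroup f s) : alg_aut L :=
  AlgAut (ore_lift_linear (eigen_x s) (eigen_y s))
         (ore_lift_monoid (eigen_rel hs)) (eigen_bij hs).

Lemma eigen_autX s (hs : eigengroup f s) :
  eigen_aut hs x = aut_slope s *: x + (aut_const s)%:A.
Proof. exact: ore_lift_x. Qed.

Lemma eigen_autY s (hs : eigengroup f s) :
  eigen_aut hs y = aut_slope s ^ ((size f).-1%:Z - 1) *: y.
Proof. exact: ore_lift_y. Qed.

Lemma eigen_autM s t (hs : eigengroup f s) (ht : eigengroup f t)
    (hst : eigengroup f (s * t)%g) :
  eigen_aut hst = (eigen_aut hs * eigen_aut ht)%g.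
Proof.
apply: alg_aut_ext; rewrite autME.
  by rewrite /= !ore_lift_x eigen_liftxE.
by rewrite /= !ore_lift_y eigen_liftyE.
Qed.

Lemma eigen_aut_inj s t (hs : eigengroup f s) (ht : eigengroup f t) :
  eigen_aut hs = eigen_aut ht -> s = t.
Proof.
move=> st; have : eigen_aut hs x = eigen_aut ht x by rewrite st.
rewrite [LHS]ore_lift_x [RHS]ore_lift_x !eigen_xE => /ore_const_inj e.
by apply: alg_autP => p; rewrite (poly_autE s p) (poly_autE t p) e.
Qed.

Definition eigengroup_aut : set (alg_aut L) :=
  [set t | exists s (hs : eigengroup f s), t = eigen_aut hs].

End EigengroupEmbedding.

Arguments shift_aut {K} f q.
Arguments shift_group {K} f _.
Arguments eigengroup_aut {K} f _.

(* Main.v *)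
(* The commutators of Lambda f lie in the two-sided ideal generated by f, and f
   itself is the commutator of y and x.  Hence an automorphism s sends f to f R,
   and comparing with s^-1 shows that R is a unit, i.e. a nonzero scalar.  Since
   degrees in y are additive, f(s(x)) = c f(x) with f nonscalar forces s(x) to
   have degree 0 in y; thus s preserves K[x] and restricts there to an element of
   the eigengroup of f.  After composing with the corresponding eigen
   automorphism we may assume s(x) = x.  Surjectivity then forces s(y) to be of
   degree 1 in y, and the relation yx - xy = f makes it monic: s(y) = y + q. *)
Require Import Defs.
From mathcomp Require Import all_boot all_order all_algebra.
From mathcomp Require Import boolp classical_sets.

Set Implicit Arguments.
Unset Strict Implicit.
Unset Printing Implicit Defensive.

Import GRing.Theory.
Local Open Scope ring_scope.

(** * Degree in y and commutators *)

Section OreDegree.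
Variables (K : fieldType) (f : {poly K}).
Local Notation L := (Lambda f).
Local Notation PP := {poly {poly K}}.
Implicit Types P Q : L.

Lemma size_ore_lmuly_sub (P : PP) :
  (size (ore_lmuly f P - P * 'X)%R <= size P)%N.
Proof. by rewrite /ore_lmuly addrAC subrr add0r size_poly. Qed.

(** The derivation part of [ore_lmuly] does not raise the degree in y, so left multiplication by y^i
    has the same leading term as the commutative multiplication by ['X^i]. *)
Lemma size_iter_ore_lmuly_sub i (P : PP) : P != 0 ->
  (size (iter i (ore_lmuly f) P - P * 'X^i)%R < size P + i)%N.
Proof.
move=> P0; elim: i => [|i IH].
  by rewrite expr0 mulr1 subrr size_poly0 addn0 size_poly_gt0.
set R := iter i (ore_lmuly f) P in IH *.
have -> : iter i.+1 (ore_lmuly f) P - P * 'X^(i.+1) =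
          (ore_lmuly f R - R * 'X) + (R - P * 'X^i) * 'X.
  by rewrite mulrBl exprSr mulrA addrA subrK.
have sR : (size R <= size P + i)%N.
  rewrite -[R](subrK (P * 'X^i)) (leq_trans (size_polyD _ _)) //.
  rewrite geq_max (ltnW IH) (leq_trans (size_polyMleq _ _)) //.
  by rewrite size_polyXn addnS.
rewrite addnS ltnS (leq_trans (size_polyD _ _)) // geq_max.
rewrite (leq_trans (size_ore_lmuly_sub _)) //=.
by rewrite (leq_trans (size_polyMleq _ _)) // size_polyX addn2.
Qed.

(** The Ore product differs from the commutative product [R] of the underlying polynomials only in
    lower degree, and degrees add in the domain K[x][X]. *)
Lemma size_ore_mul P Q : P != 0 -> Q != 0 ->
  size (P * Q : PP) = (size (P : PP) + size (Q : PP)).-1.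
Proof.
move=> P0 Q0; pose R : PP := (P : PP) * (Q : PP).
have sP : (0 < size (P : PP))%N by rewrite size_poly_gt0.
have sQ : (0 < size (Q : PP))%N by rewrite size_poly_gt0.
have sR : size R = (size (P : PP) + size (Q : PP)).-1 by rewrite size_mul.
rewrite -sR -[P * Q : PP](subrK R) addrC size_polyDl // sR.
have -> : (P * Q : PP) - R = \sum_(i < size (P : PP))
    (P : PP)`_i *: (iter i (ore_lmuly f) Q - (Q : PP) * 'X^i).
  under [RHS]eq_bigr do rewrite scalerBr.
  rewrite sumrB; congr (_ - _).
  rewrite /R -[P in LHS]coefK poly_def mulr_suml; apply: eq_bigr => i _.
  by rewrite -scalerAl mulrC.
have -> : (size (P : PP) + size (Q : PP)).-1
   = ((size (P : PP)).-1 + (size (Q : PP)).-1).+1.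
  by rewrite -addSn prednK // -subn1 -addnBA // subn1.
rewrite ltnS; apply: leq_trans (size_sum _ _ _) _.
apply/bigmax_leqP => i _ {R sR}.
apply: leq_trans (size_scale_leq _ _) _.
have := size_iter_ore_lmuly_sub i Q0.
move: (size (iter i (ore_lmuly f) Q - (Q : PP) * 'X^i : PP)%R) => m.
move: (nat_of_ord i) (ltn_ord i) => j.
case: (size (P : PP)) sP => // p' _; case: (size (Q : PP)) sQ => // q' _.
rewrite addSn !ltnS => jp mq.
by rewrite (leq_trans mq) //= addnC leq_add2r.
Qed.

(** Each Horner step multiplies by [Q], which adds its positive degree, and then adds a term of
    degree 0, which leaves the leading term alone. *)
Lemma size_horner_ore_const (p : PP) Q : p != 0 -> (1 < size (Q : PP))%N ->
  size ((map_poly (ore_const f) p).[Q] : PP)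
    = ((size p).-1 * (size (Q : PP)).-1).+1.
Proof.
move=> + Q1; have Q0 : Q != 0 by rewrite -size_poly_gt0 ltnW.
have constE c (R : L) : (R + ore_const f c : PP) = (R : PP) + c%:P by [].
elim/poly_ind: p => [|p c IH]; first by rewrite eqxx.
rewrite rmorphD rmorphM /= map_polyX map_polyC hornerMXaddC constE.
have [->|p0 _] := eqVneq p 0.
  rewrite mul0r add0r polyC_eq0 => c0.
  by rewrite rmorph0 horner0 mul0r add0r !size_polyC c0.
have {}IH := IH p0.
have R0 : (map_poly (ore_const f) p).[Q] != 0 :> PP.
  by rewrite -size_poly_gt0 IH.
have sM : size (((map_poly (ore_const f) p).[Q] * Q : L) : PP)
    = ((size p) * (size (Q : PP)).-1).+1.
  rewrite size_ore_mul // IH addSn /= -(prednK (ltnW Q1)) addnS /=.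
  by rewrite addnC -mulSn prednK // size_poly_gt0.
rewrite size_polyDl ?sM; last first.
  rewrite (leq_ltn_trans (size_polyC_leq1 c)) // ltnS muln_gt0.
  by rewrite size_poly_gt0 p0 -ltnS prednK // ltnW.
by rewrite size_MXaddC (negPf p0).
Qed.

(** The derivation f d/dx vanishes modulo f, so modulo f the Ore product is the commutative one. *)
Lemma ore_commutator_ideal P Q : exists R, P * Q - Q * P = ore_const f f * R.
Proof.
have iterE i (U : PP) : exists V : PP,
    iter i (ore_lmuly f) U = U * 'X^i + f *: V.
  elim: i => [|i [V e]]; first by exists 0; rewrite expr0 mulr1 scaler0 addr0.
  exists (V * 'X + map_poly (@deriv _) (iter i (ore_lmuly f) U)).
  rewrite [LHS]/(ore_lmuly f (iter i (ore_lmuly f) U)) /ore_lmuly {1}e mulrDl.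
  rewrite scalerDr -scalerAl addrA exprSr mulrA; congr (_ + _).
  by apply/polyP=> j; rewrite coefZ !coef_map_id0 ?raddf0.
have mulE (U W : L) : exists V : PP, U * W = (U : PP) * (W : PP) + f *: V :> PP.
  exists (\sum_(i < size (U : PP)) (U : PP)`_i *: projT1 (cid (iterE i W))).
  rewrite -[U * W]/(ore_mul U W) /ore_mul -[X in X * _]coefK poly_def.
  rewrite mulr_suml scaler_sumr -big_split /=; apply: eq_bigr => i _.
  case: cid => V /= ->.
  by rewrite scalerDr !scalerA [f * _]mulrC -scalerAl ['X^i * _]mulrC.
have [V eV] := mulE P Q; have [W eW] := mulE Q P.
exists ((V : L) - (W : L)); rewrite ore_constM scalerBr.
rewrite -[P * Q - Q * P]/((P * Q : PP) - (Q * P : PP)) eV eW.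
by rewrite [(Q : PP) * _]mulrC opprD addrACA subrr add0r.
Qed.

End OreDegree.

(** * Images of x and y under an automorphism *)

Section AutomorphismsOfLambda.
Variables (K : fieldType) (f : {poly K}).
Local Notation L := (Lambda f).
Local Notation PP := {poly {poly K}}.
Local Notation x := (ore_x f).
Local Notation y := (ore_y f).
Implicit Types (s : alg_aut L) (P Q : L).

Lemma alg_aut_const s p : s (ore_const f p) = horner_alg (s x) p.
Proof.
elim/poly_ind: p => [|p c IH]; first by rewrite !rmorph0.
rewrite !(rmorphD, rmorphM) /= IH horner_algX horner_algC; congr (_ + _).
by rewrite -[c%:P]alg_polyC !linearZ /= !rmorph1.
Qed.

Lemma alg_aut_fixX s P :
  s x = x -> s P = (map_poly (ore_const f) P).[s y].
Proof.
move=> sx; rewrite {1}[P]ore_expand rmorph_sum -[P in RHS]coefK poly_def.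
rewrite !raddf_sum horner_sum; apply: eq_bigr => i _ /=.
rewrite rmorphM rmorphXn /= alg_aut_const sx horner_alg_ore_const comp_polyXr.
by rewrite map_polyZ map_polyXn hornerZ hornerXn.
Qed.

Lemma alg_autV_K s P : (s^-1)%g (s P) = P.
Proof. by rewrite -autME mulVg aut1E. Qed.

Lemma alg_autK_V s P : s ((s^-1)%g P) = P.
Proof. by rewrite -autME mulgV aut1E. Qed.

Lemma alg_aut_neq0 s P : (s P != 0) = (P != 0).
Proof.
by rewrite -(inj_eq (bij_inj (aut_bij s)) P 0) rmorph0.
Qed.

Lemma alg_aut_eigen s : f != 0 ->
  exists2 c : K, c != 0 & s (ore_const f f) = c *: ore_const f f.
Proof.
move=> f0; pose F := ore_const f f.
(* [F] is the commutator of y and x, so [t F] is again a commutator. *)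
have im (t : alg_aut L) : exists R, t F = F * R.
  have [R eR] := ore_commutator_ideal (t y) (t x).
  by exists R; rewrite -eR -!rmorphM -rmorphB ore_rel.
have [R eR] := im s; have [R' eR'] := im (s^-1)%g.
have F0 : F != 0 by rewrite /F raddf_eq0 //; exact: ore_const_inj.
have mul_neq0 (U V : L) : U != 0 -> V != 0 -> U * V != 0.
  move=> U0 V0; rewrite -size_poly_gt0 size_ore_mul //.
  rewrite -(size_poly_gt0 (U : PP)) -(size_poly_gt0 (V : PP)) in U0 V0.
  by rewrite -(prednK U0) addSn /= addn_gt0 V0 orbT.
have FK U : F * U = F -> U = 1.
  move=> FU; apply/eqP; rewrite -subr_eq0; apply: contraT => U1.
  by have := mul_neq0 _ _ F0 U1; rewrite mulrBr mulr1 FU subrr eqxx.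
(* Cancel [F] in F = s(s^-1(F)) = s(F R') = F R s(R'). *)
have RR : R * s R' = 1.
  by apply: FK; rewrite mulrA -eR -rmorphM -eR' /= alg_autK_V.
have R0 : R != 0.
  by apply/eqP=> R0; move/eqP: RR; rewrite R0 mul0r eq_sym oner_eq0.
have sR0 : s R' != 0.
  by apply/eqP=> R'0; move/eqP: RR; rewrite R'0 mulr0 eq_sym oner_eq0.
have := congr1 (fun P : L => size (P : PP)) RR.
rewrite /= size_ore_mul // size_poly1.
have := R0; have := sR0.
rewrite -!(size_poly_gt0 (_ : PP)) => s1 s2 sz.
(* The degrees in y of the two factors add up to 0, so both factors lie in K[x] and are units
   there. *)
have [/eqP R1 /eqP R'1] : size (R : PP) = 1%N /\ size (s R' : PP) = 1%N.
  move: sz s1 s2; case: (size (R : PP)) => // m.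
  case: (size (s R' : PP)) => // n; rewrite addSn addnS /= => -[] /eqP.
  by rewrite addn_eq0 => /andP[/eqP-> /eqP->].
have [r _ er] : exists2 r, r != 0 & R = ore_const f r by apply/size_poly1P.
have [r' _ er'] : exists2 r, r != 0 & s R' = ore_const f r by apply/size_poly1P.
move: RR; rewrite er er' -rmorphM -(rmorph1 (ore_const f)) => /ore_const_inj.
move=> rr; have : r \is a GRing.unit.
  by apply/unitrPr; exists r'.
rewrite poly_unitE => /andP[/size_poly1P[c c0 ec] _].
exists c => //; rewrite eR er ec.
by rewrite -[c%:P]alg_polyC linearZ /= rmorph1 -scalerAr mulr1.
Qed.

Lemma alg_aut_x_const s : (1 < size f)%N -> exists u, s x = ore_const f u.
Proof.
move=> f1; have f0 : f != 0 by rewrite -size_poly_gt0 ltnW.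
have [c c0 e] := alg_aut_eigen s f0.
suff /size1_polyC -> : (size (s x : PP) <= 1)%N by exists (s x : PP)`_0.
rewrite leqNgt; apply/negP => sx.
(* The scalar coefficients of f are viewed as constants of K[x], so that the degree formula for
   Horner evaluation applies. *)
have hE : horner_alg (s x) f =
    (map_poly (ore_const f) (map_poly polyC f)).[s x].
  rewrite /horner_alg /= /horner_morph -map_poly_comp; congr _.[_].
  apply: eq_map_poly => a /=.
  by rewrite -alg_polyC linearZ /= rmorph1.
(* The degrees in y give deg f * deg (s x) = 0 with both factors positive. *)
have := congr1 (fun P : L => size (P : PP)) e.
rewrite /= alg_aut_const hE size_horner_ore_const ?map_poly_eq0 //.
rewrite size_map_polyC -[c *: _]/(c%:P *: (f%:P : PP)) size_scale ?polyC_eq0 //.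
rewrite size_polyC f0 => -[] /eqP.
rewrite muln_eq0; case: (size f) f1 => [|[|m]] // _.
by case: (size (s x : PP)) sx => [|[|m']].
Qed.

Lemma alg_aut_fix_shift s : f != 0 -> s x = x -> exists q, s = shift_aut f q.
Proof.
move=> f0 sx.
have rel : s y * x - x * s y = ore_const f f.
  rewrite -{1 2}sx -!rmorphM -rmorphB ore_rel /= alg_aut_const sx.
  by rewrite horner_alg_ore_const comp_polyXr.
(* Otherwise [s y] lies in K[x] and commutes with x, which would give f = 0. *)
have b1 : (1 < size (s y : PP))%N.
  rewrite ltnNge; apply/negP => /size1_polyC e.
  move: rel; rewrite e -[_%:P]/(ore_const f (s y : PP)`_0) -!rmorphM mulrC.
  rewrite subrr -(rmorph0 (ore_const f)) => /ore_const_inj /esym/eqP.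
  by rewrite (negPf f0).
(* Since s fixes K[x], y = s(P) is [P] evaluated at [s y]; hence deg P * deg (s y) = 1. *)
have b2 : size (s y : PP) = 2%N.
  pose P := (s^-1)%g y.
  have P0 : P != 0 :> PP.
    by rewrite -(alg_aut_neq0 s) alg_autK_V polyX_eq0.
  have := alg_aut_fixX P sx; rewrite alg_autK_V.
  move/(congr1 (fun P : L => size (P : PP))) => /=.
  rewrite size_horner_ore_const // size_polyX => -[] /esym/eqP.
  by rewrite muln_eq1 => /andP[_ /eqP e]; rewrite -(prednK (ltnW b1)) e.
pose a i := (s y : PP)`_i.
have bE : s y = ore_const f (a 1%N) * y + ore_const f (a 0%N).
  rewrite [LHS]ore_expand b2 big_ord_recr big_ord1 /= expr0 expr1 mulr1.
  by rewrite addrC.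
exists (a 0%N); apply: alg_aut_ext; rewrite ?shift_autX ?shift_autY //.
(* The commutator of a_1 y + a_0 with x is a_1 f, while [rel] says that it is f. *)
suff a1 : a 1%N = 1 by rewrite bE a1 rmorph1 mul1r.
apply: (mulIf f0); apply: (@ore_const_inj K f); rewrite mul1r -[RHS]rel bE.
rewrite mulrDl mulrDr opprD addrACA -!rmorphM [_ * a 0%N]mulrC subrr addr0.
by rewrite rmorphM /= -ore_rel mulrBr !mulrA -!rmorphM [_ * a 1%N]mulrC.
Qed.

(** The images u and v of x under s and s^-1 are inverse to each other under composition, so
    substituting u is an automorphism of K[x]; [alg_aut_eigen] puts it in the eigengroup. *)
Lemma alg_aut_restr_eigen s : (1 < size f)%N ->
  exists t (ht : eigengroup f t), s x = eigen_aut ht x.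
Proof.
move=> f1; have f0 : f != 0 by rewrite -size_poly_gt0 ltnW.
have [u su] := alg_aut_x_const s f1; have [v sv] := alg_aut_x_const s^-1%g f1.
have constE (t : alg_aut L) w q :
    t x = ore_const f w -> t (ore_const f q) = ore_const f (q \Po w).
  by move=> tx; rewrite alg_aut_const tx horner_alg_ore_const.
have uv : u \Po v = 'X.
  by apply: (@ore_const_inj K f); rewrite -(constE _ _ _ sv) -su alg_autV_K.
have vu : v \Po u = 'X.
  by apply: (@ore_const_inj K f); rewrite -(constE _ _ _ su) -sv alg_autK_V.
have lin : linear (fun q => q \Po u).
  by move=> a q r; rewrite comp_polyD comp_polyZ.
have mon : monoid_morphism (fun q => q \Po u).
  by split=> [|q r]; rewrite ?comp_polyM // -[1]/(1%:P) comp_polyC.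
have bij : bijective (fun q => q \Po u).
  exists (fun q => q \Po v) => q; by rewrite -comp_polyA ?uv ?vu comp_polyXr.
pose t : alg_aut {poly K} := AlgAut lin mon bij.
have ht : eigengroup f t.
  have [c c0 e] := alg_aut_eigen s f0; exists c; split=> //.
  by apply: (@ore_const_inj K f); rewrite -(constE _ _ _ su) e linearZ.
exists t, ht; rewrite su [RHS]ore_lift_x eigen_xE; congr ore_const.
by rewrite /= comp_polyX.
Qed.

End AutomorphismsOfLambda.

(** * The semidirect product decomposition *)

Theorem theorem1p2 (K : fieldType) (p : nat) (charK : p \in [pchar K])
    (f : {poly K}) (f_monic : f \is monic) (f_nonscalar : (1 < size f)%N) :
  @is_semidirect_product (alg_aut (Lambda f))
    (shift_group f) (eigengroup_aut f).
Proof.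
have f0 : f != 0 by exact: monic_neq0.
have shift0 : shift_aut f 0 = 1%g.
  by apply: alg_aut_ext; rewrite ?shift_autX ?shift_autY ?rmorph0 ?addr0.
have e1 : eigengroup f (1%g : alg_aut {poly K}).
  by exists 1; rewrite oner_neq0 scale1r.
have eigen1 : eigen_aut e1 = 1%g.
  by apply: alg_aut_ext; rewrite /= ?ore_lift_x ?ore_lift_y ?eigen_x1 ?eigen_y1.
have eigM s t : eigengroup f s -> eigengroup f t -> eigengroup f (s * t)%g.
  move=> [c [c0 sf]] [d [d0 tf]]; exists (d * c); rewrite mulf_neq0 //.
  by rewrite autME tf linearZ /= sf scalerA.
have eigV s (hs : eigengroup f s) :
    (eigen_aut hs)^-1%g = eigen_aut (eigengroupV hs).
  apply: (mulgI (eigen_aut hs)); rewrite mulgV -eigen1.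
  (* The proof [e1] is generalized so that the 1 in its type can be replaced by s s^-1. *)
  by move: e1 {eigen1}; rewrite -(mulgV s) => e1; exact: eigen_autM.
split.
- split.
    split; first by exists 0.
      by move=> _ _ [q ->] [r ->]; exists (q + r); rewrite shift_autD.
    move=> _ [q ->]; exists (- q); apply: (mulgI (shift_aut f q)).
    by rewrite mulgV -shift_autD subrr shift0.
  (* It suffices that the conjugate fixes x: g^-1(x) lies in K[x], which shifts fix pointwise. *)
  move=> g _ [q ->]; apply: alg_aut_fix_shift => //.
  have [u gu] := alg_aut_x_const g^-1%g f_nonscalar.
  by rewrite !autME gu shift_aut_const -gu alg_autK_V.
- split; first by exists 1%g, e1.
    move=> _ _ [s [hs ->]] [t [ht ->]]; exists (s * t)%g, (eigM _ _ hs ht).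
    exact/esym/eigen_autM.
  by move=> _ [s [hs ->]]; exists s^-1%g, (eigengroupV hs); rewrite eigV.
(* Taking t from g^-1 makes g * [eigen_aut ht] fix x, so the shift comes out as the left factor of
   g. *)
- move=> g; have [t [ht gx]] := alg_aut_restr_eigen g^-1%g f_nonscalar.
  have /(alg_aut_fix_shift f0)[q gq] : (g * eigen_aut ht)%g (ore_x f) = ore_x f.
    by rewrite autME -gx alg_autK_V.
  exists (shift_aut f q), (eigen_aut (eigengroupV ht)); split; first by exists q.
    by exists t^-1%g, (eigengroupV ht).
  by rewrite -gq -eigV mulgK.
- move=> g; split=> [[[q ->] [t [ht qt]]]|->]; last first.
    by split; [exists 0 | exists 1%g, e1].
  (* A shift fixes x, and t is determined by the image of x. *)
  rewrite qt -eigen1; have t1 : t = 1%g.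
    apply: alg_autP => r; rewrite aut1E poly_autE -[RHS]comp_polyXr.
    congr comp_poly; apply: (@ore_const_inj K f).
    by rewrite -eigen_xE -/(ore_x f) -(shift_autX f q) qt /= ore_lift_x.
  by move: ht {qt}; rewrite t1 => ht; congr eigen_aut; exact: Prop_irrelevance.
Qed.
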